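(* Let $L$ be a non-zero normed linear space over $\mathbb{F}$. Then $L$ can be isometrically embedded into $C(Y)$ for some compact Hausdorff space $Y$ of density at most $2^{\,\mathrm{d}(L)}$, that is, with $\mathrm{d}(Y)\leq 2^{\,\mathrm{d}(L)}$.
   Context: The field of scalars $\mathbb{F}$ is fixed throughout and is either $\mathbb{R}$ or $\mathbb{C}$. For a compact Hausdorff space $X$, $C(X)$ denotes the set of all continuous $\mathbb{F}$-valued mappings on $X$, which is a normed linear space over $\mathbb{F}$ with the supremum norm and pointwise addition and scalar multiplication. An isometric embedding of $L$ into $C(Y)$ is a mapping $L\to C(Y)$ preserving addition, scalar multiplication and norm. The density of a topological space $X$ is the cardinal $\mathrm{d}(X)=\min\{|D|:D\text{ is dense in }X\}$; for the normed linear space $L$, $\mathrm{d}(L)$ is taken with respect to the norm topology. *)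

(* Defs.v *)
From mathcomp Require Import all_boot all_order all_algebra.
From mathcomp Require Import complex.
From mathcomp Require Import all_classical all_reals all_analysis.

Set Implicit Arguments.
Unset Strict Implicit.
Unset Printing Implicit Defensive.

Import Order.TTheory GRing.Theory Num.Theory.
Import numFieldNormedType.Exports.

Local Open Scope classical_set_scope.
Local Open Scope card_scope.
Local Open Scope ring_scope.

Variant scalar_kind := RealScalars | ComplexScalars.

Definition scalar_field (R : realType) (k : scalar_kind) : numFieldType :=
  match k with
  | RealScalars => R
  | ComplexScalars => R[i]
  end.

Section least_cardinality.
Variables (T : Type) (P : set (set T)).

(* Honig's argument: a maximal set of choice functions of the family P, any two
   of which differ at every member of P, takes all values at some member. *)
Lemma ex_least_card : P !=set0 ->
  exists2 D, P D & forall E, P E -> D #<= E.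
Proof.
move=> [D0 PD0].
pose I := {A | P A}.
pose good (B : set (I -> T)) :=
  (forall b, B b -> forall i : I, sval i (b i)) /\
  (forall b c i, B b -> B c -> b i = c i -> b = c).
have [|B [[Bin Binj] Bmax]] := @Zorn_bigcup _ good.
  move=> F Fgood Ftot; split=> [b [X FX Xb] i|b c i [X FX Xb] [Y FY Yc]].
    exact: (Fgood _ FX).1.
  have [XY|YX] := Ftot _ _ FX FY.
  - exact: (Fgood _ FY).2 (XY _ Xb) Yc.
  - exact: (Fgood _ FX).2 Xb (YX _ Yc).
have [i isurj] : exists i : I, forall t, sval i t -> exists2 b, B b & b i = t.
  apply: contrapT => /forallNP nsurj.
  have /choice[x xP] : forall i : I, exists t, sval i t /\
      forall b, B b -> b i <> t.
    move=> i; have /existsNP[t /not_implyP[it nt]] := nsurj i.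
    by exists t; split=> // b Bb bit; apply: nt; exists b.
  have xB : ~ B x by move=> Bx; exact: (xP (exist _ D0 PD0)).2 Bx erefl.
  apply: (Bmax (B `|` [set x])).
    by split=> [b Bb|BxB]; [left|apply: xB; apply: BxB; right].
  split=> [b [/Bin//|-> j]|b c j [Bb|->] [Bc|->] //].
  - exact: (xP j).1.
  - exact: Binj.
  - by move=> e; have := (xP j).2 _ Bb e.
  - by move=> e; have := (xP j).2 _ Bc (esym e).
exists (sval i); first exact: (svalP i).
move=> E PE; pose j : I := exist _ E PE.
have /choice[f fP] : forall t, exists u,
    sval i t -> exists b, [/\ B b, b i = t & b j = u].
  move=> t; have [/isurj[b Bb bt]|nit] := pselect (sval i t).
    by exists (b j) => _; exists b.
  by exists t.
have [|g] := (@injfunPex _ _ (sval i) E).2; last exact: inj_card_le g.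
exists f => [t /fP[b [Bb _ <-]]|t u /[!inE] /fP[b [Bb <- <-]] /fP[c [Bc <- <-]]].
  exact: (Bin _ Bb j).
by move=> /(Binj _ _ _ Bb Bc) ->.
Qed.

End least_cardinality.

(* The cardinal d(T) is represented by a dense set of least cardinality, to be
   used only through the cardinality comparison #<=. *)
Definition density (T : topologicalType) : set T :=
  xget setT [set D | dense D /\ forall E : set T, dense E -> D #<= E].
Arguments density T : clear implicits.

Lemma densityP (T : topologicalType) :
  dense (density T) /\ forall E : set T, dense E -> density T #<= E.
Proof.
rewrite /density; case: xgetP => // nD; exfalso.
have [|D dD leD] := @ex_least_card T (@dense T); last exact: (nD D).
by exists setT => A A0 _; rewrite setIT.
Qed.

(* The supremum is taken in F itself, whose order is partial when F is R[i];
   the least upper bound of a nonempty set of norms is the usual real one. *)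
Definition sup_norm (F : numFieldType) (Y : topologicalType)
    (f : continuousType Y F) : F :=
  supremum 0 (range (fun y => `|f y|)).

Definition isometric_embedding (F : numFieldType) (L : normedModType F)
    (Y : topologicalType) (J : L -> continuousType Y F) : Prop :=
  [/\ forall (u v : L) (y : Y), J (u + v) y = J u y + J v y,
      forall (a : F) (u : L) (y : Y), J (a *: u) y = a * J u y &
      forall u : L, sup_norm (J u) = `|u| ].

(* Main.v *)
Require Import Defs.
From HB Require Import structures.
From mathcomp Require Import all_boot all_order all_algebra.
From mathcomp Require Import complex.
From mathcomp Require Import all_classical all_reals all_analysis.
From mathcomp Require Import ring lra.
Import numFieldNormedType.Exports.

(** The space [Y] is the weak-* closure of a family of norming functionals.
Write [D] for a dense subset of [L] of least cardinality. By Hahn-Banach every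
[u] in [D] has a linear functional [f u] of norm at most 1 with
[`|f u u| = `|u|]. Let [Y] be the closure of [f @` D] in the product of copies
of the scalar field indexed by [L], and send [u] to the evaluation
[g |-> g u] on [Y].

Being linear and contractive is a closed condition in the product topology, so
it passes from [f @` D] to [Y] ([closed_contractive_functional]). Hence [Y] is a
closed subset of a product of compact sets and is compact by Tychonoff, the
evaluations depend linearly on [u], and they satisfy [`|g u| <= `|u|]. The
supremum is [`|u|]: if [v] in [D] is close to [u] then [f v] almost attains
[`|u|] at [u], since it attains [`|v|] at [v] and is contractive. Finally
[f @` D] is dense in [Y], so the density of [Y] is at most the cardinality of
[D], which is below that of its power set. All of this is carried out over
any scalar field with compact bounded sets and enough norming functionals
([embedding_of_norming]).

Hahn-Banach is obtained without extending functionals from subspaces: a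
minimal sublinear functional is linear ([minimal_sublinear_linear]), and Zorn's
lemma provides one below a given [p]. Over [R[i]] a real functional [g] below
the norm is turned into the complex one [v |-> g v - 'i * g ('i *: v)]. *)

Set Implicit Arguments.
Unset Strict Implicit.
Unset Printing Implicit Defensive.

Import Order.TTheory GRing.Theory Num.Theory.

Local Open Scope classical_set_scope.
Local Open Scope card_scope.
Local Open Scope ring_scope.

(** * Sublinear functionals and the Hahn-Banach theorem *)

Section sublinear.
Variables (R : realType) (V : lmodType R).
Implicit Types (p q : V -> R) (u v x y : V).

(** Homogeneity is required as an inequality, which is what infima of sublinear
functionals satisfy directly; equality follows in [sublinearZ]. *)
Definition sublinear p :=
  (forall x y, p (x + y) <= p x + p y) /\
  (forall (a : R) x, 0 <= a -> p (a *: x) <= a * p x).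

Lemma sublinear0 p : sublinear p -> p 0 = 0.
Proof.
move=> [pD pZ]; apply/eqP; rewrite eq_le; apply/andP; split.
  by have := pZ 0 0 (lexx 0); rewrite scale0r mul0r.
by have := pD 0 0; rewrite addr0; lra.
Qed.

Lemma sublinear_opp p x : sublinear p -> - p (- x) <= p x.
Proof.
move=> sp; have := sp.1 x (- x); rewrite subrr (sublinear0 sp); lra.
Qed.

(** Both constructions below are pointwise infima. It is enough that the members
of the family satisfy subadditivity and homogeneity jointly: each bound may be
met by a further member [k]. The bound [b] makes the infima genuine lower bounds.
*)
Lemma sublinear_inf (I : Type) (A : set I) (f : I -> V -> R) (b : V -> R) :
  A !=set0 ->
  (forall i x, A i -> b x <= f i x) ->
  (forall i j x y, A i -> A j ->
    exists2 k, A k & f k (x + y) <= f i x + f j y) ->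
  (forall i (a : R) x, A i -> 0 <= a ->
    exists2 k, A k & f k (a *: x) <= a * f i x) ->
  let q x := inf [set f i x | i in A] in
  sublinear q /\ forall i x, A i -> q x <= f i x.
Proof.
move=> [i0 Ai0] bf fD fZ q.
have qle i x : A i -> q x <= f i x.
  move=> Ai; apply: ge_inf; last by exists i.
  by exists (b x) => _ [j Aj <-]; exact: bf.
have leinf x c : (forall i, A i -> c <= f i x) -> c <= q x.
  move=> cf; apply: lb_le_inf; first by exists (f i0 x), i0.
  by move=> _ [i Ai <-]; exact: cf.
split=> //; split=> [x y|a x a0].
  rewrite -lerBlDr; apply/leinf => i Ai; rewrite lerBlDr -lerBlDl.
  apply/leinf => j Aj; rewrite lerBlDl.
  by have [k Ak] := fD i j x y Ai Aj; exact/le_trans/qle.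
have [->|an0] := eqVneq a 0.
  by have [k Ak] := fZ i0 0 x Ai0 (lexx 0); rewrite !mul0r; exact/le_trans/qle.
have {an0}a0 : 0 < a by rewrite lt_neqAle eq_sym an0.
rewrite -ler_pdivrMl//; apply/leinf => i Ai; rewrite ler_pdivrMl//.
by have [k Ak] := fZ i a x Ai (ltW a0); exact/le_trans/qle.
Qed.

Lemma sublinearZ p (a : R) x : sublinear p -> 0 <= a -> p (a *: x) = a * p x.
Proof.
move=> sp a0; have [->|an0] := eqVneq a 0.
  by rewrite scale0r mul0r sublinear0.
apply/le_anti; rewrite sp.2//= -ler_pdivlMl ?lt_neqAle 1?eq_sym ?an0//.
rewrite -[in leLHS](scalerK an0 x); apply: sp.2.
by rewrite invr_ge0.
Qed.

(** Lowering [p] along the direction [v]: the infimum over [t >= 0] of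
[p (x + t *: v) - t * p v]. The value [t = 0] gives a functional below [p], and
[t = 1] gives the reverse triangle inequality [q x + p v <= p (x + v)]. *)
Lemma sublinear_tilt p v : sublinear p ->
  exists q, [/\ sublinear q, forall x, q x <= p x &
    forall x, q x <= p (x + v) - p v].
Proof.
move=> sp; have [pD pZ] := sp.
have [||||/=sq qle] := @sublinear_inf R [set t | 0 <= t]
  (fun t x => p (x + t *: v) - t * p v) (fun x => - p (- x)).
- by exists 0 => /=.
- move=> t x /= t0; have := pD (- x) (x + t *: v).
  by rewrite addKr sublinearZ//; lra.
- move=> s t x y /= s0 t0; exists (s + t); first exact: addr_ge0.
  rewrite scalerDl addrACA; have := pD (x + s *: v) (y + t *: v); lra.
- move=> t a x /= t0 a0; exists (a * t); first exact: mulr_ge0.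
  by rewrite -scalerA -scalerDr sublinearZ//; lra.
exists (fun x => inf [set p (x + t *: v) - t * p v | t in [set t | 0 <= t]]).
split=> // x.
- by have := qle 0 x (lexx 0); rewrite scale0r addr0 mul0r subr0.
- by have := qle 1 x ler01; rewrite scale1r mul1r.
Qed.

(** Zorn's lemma applies since a chain of sublinear functionals below [p] is
bounded below by [x |-> - p (- x)], and subadditivity of its infimum follows by
comparing two members with the smaller of them. *)
Lemma minimal_sublinear p : sublinear p ->
  exists q, [/\ sublinear q, forall x, q x <= p x &
    forall q', sublinear q' -> (forall x, q' x <= q x) -> q' = q].
Proof.
move=> sp.
pose T := {q | sublinear q /\ forall x, q x <= p x}.
pose mk q (sq : sublinear q) (qp : forall x, q x <= p x) : T :=
  exist _ q (conj sq qp).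
pose r (f g : T) := `[< forall x, sval g x <= sval f x >].
have [| | | |m mmin] := @Zorn T r.
- by move=> f; apply/asboolP.
- move=> f g h /asboolP fg /asboolP gh; apply/asboolP => x.
  exact: le_trans (gh x) (fg x).
- move=> [f ?] [g ?] /asboolP /= fg /asboolP /= gf; apply/eq_exist/funext => x.
  by apply/le_anti; rewrite fg gf.
- move=> C Ctot.
  have [->|/set0P[f0 Cf0]] := eqVneq C set0.
    by exists (mk p sp (fun x => lexx (p x))).
  have [||||/=sq qle] := @sublinear_inf T C sval (fun x => - p (- x)).
  + by exists f0.
  + move=> f x Cf; have [sf fp] := svalP f.
    by rewrite (le_trans _ (sublinear_opp x sf))// lerN2.
  + move=> f g x y Cf Cg.
    have [fD _] := (svalP f).1; have [gD _] := (svalP g).1.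
    have [/asboolP le|/asboolP le] := Ctot f g Cf Cg.
    * by exists g => //; rewrite (le_trans (gD _ _))// lerD.
    * by exists f => //; rewrite (le_trans (fD _ _))// lerD.
  + by move=> f a x Cf a0; exists f => //; exact: (svalP f).1.2.
  have qp x : inf [set sval i x | i in C] <= p x.
    exact: le_trans (qle f0 x Cf0) ((svalP f0).2 x).
  by exists (mk _ sq qp) => f Cf; apply/asboolP => x /=; exact: qle.
case: m mmin => m [sm mp] mmin; exists m; split=> // q sq qm.
have qp x : q x <= p x by exact: le_trans (mp x).
by have /(congr1 sval)/= := mmin (mk q sq qp) (asboolT qm).
Qed.

(** A minimal [p] equals its own tilt along [y], which reverses the triangle
inequality. *)
Lemma minimal_sublinear_linear p : sublinear p ->
  (forall q, sublinear q -> (forall x, q x <= p x) -> q = p) ->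
  (forall x y, p (x + y) = p x + p y) /\
  (forall (a : R) x, p (a *: x) = a * p x).
Proof.
move=> sp pmin.
have pD x y : p (x + y) = p x + p y.
  apply/le_anti; rewrite sp.1/=.
  have [q [sq qp qy]] := sublinear_tilt y sp.
  by have := qy x; rewrite (pmin q sq qp) lerBrDr.
split=> // a x; have [a0|/ltW a0] := leP 0 a; first exact: sublinearZ.
have pN y : p (- y) = - p y.
  by apply/eqP; rewrite -addr_eq0 -pD addNr sublinear0.
by rewrite -[a]opprK scaleNr pN sublinearZ ?oppr_ge0// !mulNr.
Qed.

(** The tilt [p1] of [p] along [u] has [p1 (- u) <= - p u], so a linear [g]
below [p1] is forced to satisfy [p u <= g u]. *)
Lemma hahn_banach p u : sublinear p ->
  exists g : V -> R,
    [/\ forall x y, g (x + y) = g x + g y,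
        forall (a : R) x, g (a *: x) = a * g x,
        forall x, g x <= p x &
        g u = p u].
Proof.
move=> sp; have [p1 [sp1 p1p p1u]] := sublinear_tilt u sp.
have [g [sg gp1 gmin]] := minimal_sublinear sp1.
have [gD gZ] := minimal_sublinear_linear sg gmin.
have gp x : g x <= p x := le_trans (gp1 x) (p1p x).
exists g; split=> //; apply/le_anti; rewrite gp/=.
have := le_trans (gp1 (- u)) (p1u (- u)).
by rewrite addNr (sublinear0 sp) sub0r -scaleN1r gZ mulN1r lerN2.
Qed.

End sublinear.

(** * Subspaces, cardinals and suprema *)

Lemma compact_set_type (T : topologicalType) (A : set T) :
  compact A -> compact [set: set_type A].
Proof.
move=> cA G PG _.
have [|p [Ap clp]] := cA (set_val @ G) _.
  by rewrite /nbhs/=; apply: filterS filterT => y _ /=; exact: set_valP.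
exists (exist _ p (mem_set Ap)); split=> // B C GB [_ [[U oU <-] Up] UC].
have [||z [[y By <-] Uy]] := clp ((set_val : set_type A -> T) @` B) U.
- have BB : B `<=` set_val @^-1` (set_val @` B) by move=> y By; exists y.
  exact: filterS BB GB.
- by apply: open_nbhs_nbhs; split=> //; exact: Up.
by exists y; split=> //; exact: UC.
Qed.

Lemma hausdorff_set_type (T : topologicalType) (A : set T) :
  hausdorff_space T -> hausdorff_space (set_type A).
Proof.
move=> hT p q clpq; apply/val_inj/hT => B C nB nC.
have cval := @initial_continuous A T set_val.
have [y [By Cy]] := clpq _ _ (cval p _ nB) (cval q _ nC).
by exists (set_val y).
Qed.

(** The points [f x] with [x] in [D] are dense in the closure of [f @` D]. The
default [y0] makes [x |-> f x] a map into the closure defined on all of [S]. *)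
Lemma density_set_type_closure (S : Type) (T : topologicalType) (D : set S)
    (f : S -> T) :
  density (set_type (closure (f @` D))) #<= D.
Proof.
set Y := set_type _.
have [Y0|/set0P[y0 _]] := eqVneq [set: Y] set0.
  have -> : density Y = set0 by rewrite -subset0 -Y0.
  exact: card_ge0.
pose g x : Y := insubd y0 (f x).
have gf x : D x -> set_val (g x) = f x.
  move=> Dx; rewrite set_valE insubdK// inE; apply: subset_closure.
  by exists x.
apply: (card_le_trans _ (card_image_le g D)); apply: (densityP Y).2.
move=> O [y Oy] [U oU UO]; rewrite -{}UO in Oy *.
have [_ [[x Dx <-] Ufx]] := set_valP y U (open_nbhs_nbhs (conj oU Oy)).
by exists (g x); split; [rewrite /= gf|exists x].
Qed.

Lemma card_le_subsets (T : Type) (D : set T) : D #<= [set A | A `<=` D].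
Proof.
have [|g] := (@injfunPex _ _ D [set A | A `<=` D]).2; last exact: inj_card_le g.
exists set1 => [x Dx _ ->//|x y _ _ /seteqP[/(_ x erefl)]]//.
Qed.

(** Stated for a partial order, as needed for the norm values in [R[i]]. *)
Lemma supremum_eq (d : Order.disp_t) (T : porderType d) (x0 s : T) (A : set T) :
  A !=set0 -> ubound A s -> lbound (ubound A) s -> supremum x0 A = s.
Proof.
move=> /set0P A0 uAs lAs; rewrite /supremum (negbTE A0).
by case: xgetP => [y _ sy|/(_ s)[]//]; exact: (is_subset1_supremums sy).
Qed.

Lemma closed_le_norm (F : numFieldType) (c : F) :
  closed [set x : F | `|x| <= c].
Proof.
move=> x clx; apply/ler_addgt0Pr => e e0.
have [y [/= yc]] := clx _ (nbhsx_ballx x e e0).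
rewrite -ball_normE /= => xy.
rewrite -(subrK y x) addrC (le_trans (ler_normD _ _))// lerD// ltW//.
Qed.

(** * The weak-* compact space of norming functionals *)

Definition contractive_functional (F : numFieldType) (L : normedModType F)
    (f : L -> F) :=
  [/\ forall u v, f (u + v) = f u + f v,
      forall a u, f (a *: u) = a * f u &
      forall u, `|f u| <= `|u|].

Section dual.
Variables (F : numFieldType) (L : normedModType F).
Local Notation W := (prod_topology (fun _ : L => F)).

Lemma evaluation_continuous (u : L) : continuous (fun f : W => f u).
Proof. exact: (@proj_continuous L (fun=> F) u). Qed.

Lemma closed_contractive_functional :
  closed [set f : W | contractive_functional f].
Proof.
have cont_eq0 (phi : W -> F) : continuous phi -> closed [set f | phi f = 0].
  move=> cphi; apply: (@preimage_closed _ _ phi [set 0]) => [f _|].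
    exact: cphi.
  exact/accessible_closed_set1/hausdorff_accessible/norm_hausdorff.
have ev := evaluation_continuous.
have -> : [set f : W | contractive_functional f] =
    \bigcap_(uv in [set: L * L])
      [set f | f (uv.1 + uv.2) - (f uv.1 + f uv.2) = 0]
    `&` (\bigcap_(au in [set: F * L])
      [set f | f (au.1 *: au.2) - au.1 * f au.2 = 0]
    `&` \bigcap_(u in [set: L]) [set f | `|f u| <= `|u|]).
  apply/seteqP; split=> [f [fD fZ fle]|f [fD [fZ fle]]].
    split=> [[u v] _|] /=; first by rewrite fD subrr.
    by split=> [[a u] _|u _] /=; [rewrite fZ subrr|exact: fle].
  split=> [u v|a u|u].
  - by apply/subr0_eq; exact: fD (u, v) I.
  - by apply/subr0_eq; exact: fZ (a, u) I.
  - exact: fle u I.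
apply: closedI; last apply: closedI; apply: closed_bigI.
- move=> [u v] _; apply: cont_eq0 => f /=.
  exact: cvgB (ev _ f) (cvgD (ev _ f) (ev _ f)).
- move=> [a u] _; apply: cont_eq0 => f /=.
  exact: cvgB (ev _ f) (cvgM (cvg_cst a) (ev _ f)).
- move=> u _; apply: (preimage_closed _ (@closed_le_norm F `|u|)) => f _.
  exact: ev.
Qed.

(** The norming functionals of a dense subset determine all norms, because
contractivity transfers the estimate from [v] to any nearby [u]. The first
hypothesis bounds the coordinate of index [u] in the compact set [K `|u|]. *)
Lemma embedding_of_norming :
  (forall r : F, exists K : set F, compact K /\ [set z | `|z| <= r] `<=` K) ->
  (forall u : L, exists f, contractive_functional f /\ `|f u| = `|u|) ->
  exists Y : topologicalType,
    [/\ compact [set: Y], hausdorff_space Y, density Y #<= density L &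
        exists J : L -> continuousType Y F, isometric_embedding J].
Proof.
move=> /choice[K KP] norming.
have /choice[f fP] : forall u : L, exists f : W,
    contractive_functional f /\ `|f u| = `|u| by [].
pose A : set W := closure (f @` density L).
have Acontr g : A g -> contractive_functional g.
  move=> Ag; apply: closed_contractive_functional.
  by apply: closure_subset Ag => _ [u _ <-]; exact: (fP u).1.
have Wh : hausdorff_space W.
  by apply: (@hausdorff_product L (fun=> F)) => u; exact: norm_hausdorff.
have Ac : compact A.
  apply: (subclosed_compact (@closed_closure _ _)).
    exact: (@tychonoff L (fun=> F) (fun u => K `|u|) (fun u => (KP _).1)).
  by move=> g /Acontr[_ _ gle] u; apply: (KP _).2; exact: gle.
exists (set_type A); split.
- exact: compact_set_type.
- exact: hausdorff_set_type.
- exact: density_set_type_closure.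
have Jc u : continuous (fun y : set_type A => set_val y u).
  move=> y; apply: (@continuous_comp _ _ _ (set_val : set_type A -> W)
    (fun g : W => g u)); first exact: initial_continuous.
  exact: evaluation_continuous.
have yP (y : set_type A) : contractive_functional (set_val y).
  exact/Acontr/set_valP.
exists (fun u => mkcts (Jc u)); split=> [u v y|a u y|u].
- by have [+ _ _] := yP y; exact.
- by have [_ + _] := yP y; exact.
have [dD _] := densityP L.
(* [e / 2] is lost from [`|u|] to [`|v|], and again from [f v v] to [f v u]. *)
have approx (e : F) : 0 < e -> exists2 y : set_type A, True &
    `|u| <= `|set_val y u| + e.
  move=> e0.
  have [||v [uv Dv]] := dD (ball u (e / 2)).
  - by exists u; apply: ballxx; rewrite divr_gt0.
  - by apply: ball_open; rewrite divr_gt0.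
  have Afv : A (f v) by apply: subset_closure; exists v.
  exists (exist _ (f v) (mem_set Afv)) => //.
  have [[fD fZ fle] fv] := fP v.
  have fB : `|f v u - f v v| <= `|u - v|.
    by have := fle (u - v); rewrite fD -scaleN1r fZ mulN1r.
  move: uv; rewrite -ball_normE /= => uv.
  rewrite -[u in leLHS](subrK v) (le_trans (ler_normD _ _))// -fv.
  rewrite -[f v v in leLHS](subKr (f v u)).
  rewrite (splitr e) addrCA lerD ?(ltW uv)//.
  rewrite (le_trans (ler_normB _ _))// lerD// (le_trans fB)// ltW//.
apply: supremum_eq.
- by have [y _ _] := approx 1 ltr01; exists `|set_val y u|; exists y.
- by move=> _ [y _ <-]; have [_ _] := yP y; exact.
- move=> M ubM; apply/ler_addgt0Pr => e /approx[y _ /le_trans]; apply.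
  by rewrite lerD2r; apply: ubM; exists y.
Qed.
End dual.

(** * Real scalars *)

Lemma norming_real (R : realType) (L : normedModType R) (u : L) :
  exists f : L -> R, contractive_functional f /\ `|f u| = `|u|.
Proof.
have [|g [gD gZ gle gu]] := @hahn_banach R L Num.norm u.
  split=> [x y|a x a0]; first exact: ler_normD.
  by rewrite normrZ ger0_norm.
exists g; split; last by rewrite gu normr_id.
split=> // v; rewrite ler_norml gle andbT lerNl -mulN1r -gZ scaleN1r.
by rewrite (le_trans (gle _))// normrN.
Qed.

Lemma bounded_in_compact_real (R : realType) (r : R) :
  exists K : set R, compact K /\ [set z | `|z| <= r] `<=` K.
Proof.
exists `[- r, r]%classic; split; first exact: segment_compact.
by move=> z /=; rewrite ler_norml in_itv.
Qed.

(** * Complex scalars *)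

(** An alias, so that restriction of scalars to [R] does not compete with the
original structure on [L]. *)
Definition realify (R : realType) (L : lmodType R[i]) : Type := L.

Section realify.
Local Open Scope complex_scope.
Variables (R : realType) (L : lmodType R[i]).

HB.instance Definition _ := GRing.Zmodule.copy (realify L) L.

Let scale (a : R) (v : realify L) : realify L := a%:C *: (v : L).

Let scaleA a b v : scale a (scale b v) = scale (a * b) v.
Proof. by rewrite /scale scalerA rmorphM. Qed.

Let scale1 : left_id 1 scale.
Proof. by move=> v; rewrite /scale rmorph1 scale1r. Qed.

Let scaleDr : right_distributive scale +%R.
Proof. by move=> a u v; rewrite /scale scalerDr. Qed.

Let scaleDl v : {morph scale^~ v : a b / a + b}.
Proof. by move=> a b; rewrite /scale rmorphD scalerDl. Qed.

HB.instance Definition _ :=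
  GRing.Zmodule_isLmodule.Build R (realify L) scaleA scale1 scaleDr scaleDl.

End realify.

Section complex.
Local Open Scope complex_scope.
Variable R : realType.
(* [R[i]] as a numeric field, which carries the norm topology. *)
Local Notation C := (Num.NumField.sort (R[i] : numFieldType)).

Lemma Re_le (x y : R[i]) : x <= y -> complex.Re x <= complex.Re y.
Proof. by rewrite lecE => /andP[]. Qed.

Lemma le_normc_Re (x r : R[i]) :
  `|x| <= r -> `|complex.Re x| <= complex.Re r.
Proof. by move=> /(le_trans (normc_ge_Re x))/Re_le. Qed.

Lemma ger0_Re (x : R[i]) : 0 <= x -> (complex.Re x)%:C = x.
Proof. by move=> x0; rewrite [RHS]complexE (ger0_Im x0) mulr0 addr0. Qed.

Lemma real_complex_continuous : continuous (fun x : R => x%:C : C).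
Proof.
move=> x A /nbhs_ballP[e /= e0 eA]; apply/nbhs_ballP.
move: (e0); rewrite -(ger0_Re (ltW e0)) ltcR => Re0.
exists (complex.Re e) => // y; rewrite -ball_normE /= => xy; apply: eA.
rewrite -ball_normE /= -(ger0_Re (ltW e0)) -rmorphB /= normc_def /=.
by rewrite expr0n addr0 sqrtr_sqr ltcR.
Qed.

(** A disc lies in the image of a square under [(a, b) |-> a + 'i b]. *)
Lemma bounded_in_compact_complex (r : C) :
  exists K : set C, compact K /\ [set z | `|z| <= r] `<=` K.
Proof.
pose I : set R := `[- complex.Re r, complex.Re r]%classic.
pose h (p : R * R) : C := p.1%:C + 'i * p.2%:C.
exists (h @` (I `*` I)); split.
  apply: continuous_compact; last first.
    by apply: compact_setX; exact: segment_compact.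
  apply: continuous_subspaceT => p; apply: cvgD; last apply: cvgM.
  - apply: (@continuous_comp _ _ C fst (fun x : R => x%:C)).
      exact: cvg_fst.
    exact: real_complex_continuous.
  - exact: cvg_cst.
  - apply: (@continuous_comp _ _ C snd (fun x : R => x%:C)).
      exact: cvg_snd.
    exact: real_complex_continuous.
move=> z /= zr; exists (complex.Re z, complex.Im z); last first.
  by rewrite /h /= -complexE.
rewrite /I; split=> /=; rewrite in_itv /= -ler_norml; first exact: le_normc_Re.
rewrite -normrN.
have -> : - complex.Im z = complex.Re ('i * z) by rewrite mulrC ReiNIm.
by apply: le_normc_Re; rewrite normrM normc_def /= expr0n add0r expr1n
  sqrtr1 mul1r.
Qed.

(** Contractivity of the complexification [f] of [g]: after rotating [v] by the
unit scalar [`|f v| / f v] the value of [f] is its real part, that is a value of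
[g], which the norm bounds. *)
Lemma norming_complex (L : normedModType C) (u : L) :
  exists f : L -> C, contractive_functional f /\ `|f u| = `|u|.
Proof.
pose p (v : realify L) : R := complex.Re (`|v : L|).
have [|g [gD gZ gle gu]] := @hahn_banach R (realify L) p u.
  split=> [x y|a x a0].
    by have := Re_le (ler_normD (x : L) (y : L)); rewrite raddfD.
  rewrite /p normrZ ger0_norm ?ler0c//.
  by case: `|_ : L| => b c /=; rewrite mul0r subr0.
(* The real-linear structure of [realify L], read back on [L]. *)
have {}gD (v w : L) : g (v + w) = g v + g w by exact: gD.
have {}gZ (a : R) (v : L) : g (a%:C *: v) = a * g v by exact: gZ.
pose f (v : L) : C := g v +i* - g ('i *: v).
have fD v w : f (v + w) = f v + f w.
  by rewrite /f scalerDr !gD; apply/eqP; rewrite eq_complex /= opprD !eqxx.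
have fZ a v : f (a *: v) = a * f v.
  case: a => a b.
  have gab (c d : R) : g ((c +i* d) *: v) = c * g v + d * g ('i *: v).
    have -> : (c +i* d) *: v = c%:C *: v + d%:C *: ('i *: v).
      by rewrite scalerA -scalerDl; congr (_ *: _); simpc.
    by rewrite gD !gZ.
  have iab : 'i * (a +i* b) = (- b) +i* a :> C by simpc.
  rewrite /f scalerA iab (gab a b) (gab (- b) a); move: (g v) (g _) => s t.
  by apply/eqP; rewrite eq_complex /=; apply/andP; split; apply/eqP; ring.
have fle v : `|f v| <= `|v|.
  have [->|fv0] := eqVneq (f v) 0; first by rewrite normr0.
  pose a : C := `|f v| / f v.
  have a1 : `|a| = 1 by rewrite normf_div normr_id divff// normr_eq0.
  have : complex.Re (f (a *: v)) <= complex.Re `|a *: v| by exact: gle.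
  by rewrite fZ divfK// normrZ a1 mul1r -lecR !ger0_Re.
exists f; split; first by split.
apply/le_anti; rewrite fle /=.
rewrite -(ger0_Re (normr_ge0 u)) -/(p u) -gu.
apply: le_trans (normc_ge_Re _); rewrite lecR /=; exact: ler_norm.
Qed.
End complex.

(** * The embedding *)

Unset Implicit Arguments.

Theorem corollary2p2 (R : realType) (k : scalar_kind)
    (L : normedModType (scalar_field R k)) :
  (exists u : L, u != 0) ->
  exists Y : topologicalType,
    [/\ compact [set: Y],
        hausdorff_space Y,
        density Y #<= [set A : set L | A `<=` density L] &
        exists J : L -> continuousType Y (scalar_field R k),
          isometric_embedding J].
Proof.
move=> _.
have [Y [cY hY dY [J JP]]] : exists Y : topologicalType,
    [/\ compact [set: Y], hausdorff_space Y, density Y #<= density L &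
        exists J : L -> continuousType Y (scalar_field R k),
          isometric_embedding J].
  case: k L => L; apply: embedding_of_norming.
  - exact: bounded_in_compact_real.
  - exact: norming_real.
  - exact: bounded_in_compact_complex.
  - exact: norming_complex.
exists Y; split=> //; last by exists J.
exact: card_le_trans dY (card_le_subsets _).
Qed.
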